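(* Let $\mathbb{F}$ be an infinite field of characteristic $p\neq 2$ (possibly $p=0$), let $d\ge 1$, and let $G$ be $O(n)$ or $Sp(n)$. Then the ideal $K_{\infty}\subset\mathcal{N}_{\sigma}$ of free relations for $R^{G}$ is zero. That is, if $f\in\mathcal{N}_\sigma$ satisfies $\Psi_n(f)=0$ for all admissible $n$ (all $n>0$ in the orthogonal case; all even $n>0$ in the symplectic case), then $f=0$.
   Context: Words. Let $\mathcal{M}$ be the monoid without unity (free semigroup) freely generated by the $2d$ letters $x_1,\ldots,x_d,x_1^T,\ldots,x_d^T$. Involution: $(x_k)^T=x_k^T$, $(x_k^T)^T=x_k$, $(a_1\cdots a_r)^T=a_r^T\cdots a_1^T$ for letters $a_i$. For $a,b\in\mathcal{M}$ write $a\stackrel{c}{\sim}b$ if $b$ is a cyclic permutation of the word $a$, and $a\sim b$ if $a\stackrel{c}{\sim}b$ or $a\stackrel{c}{\sim}b^T$. A word is primitive if it is not equal to a power of a shorter word; $\mathcal{N}\subset\mathcal{M}$ is the set of primitive words. $\mathcal{N}_\sigma$ is the commutative polynomial ring with unity over $\mathbb{F}$ freely generated by symbols $\sigma_t(a)$, where $t>0$ and $a\in\mathcal{N}$ ranges over $\sim$-equivalence classes (so $\sigma_t(a)=\sigma_t(b)$ if $a\sim b$). Matrices. $O(n)=\{A\in\mathbb{F}^{n\times n}\mid AA^T=E\}$; for $n$ even, $Sp(n)=\{A\in\mathbb{F}^{n\times n}\mid AA^{*}=E\}$, where $A^{*}=-JA^TJ$ and $J=\begin{pmatrix}0&E\\-E&0\end{pmatrix}$.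 In the symplectic case $n$ is always assumed even. Let $R=\mathbb{F}[x_{ij}(k)\mid 1\le i,j\le n,\,1\le k\le d]$ with generic matrices $X_k=(x_{ij}(k))$; $g\in G$ acts on $R$ by sending $x_{ij}(k)$ to the $(i,j)$-th entry of $g^{-1}X_kg$, and $R^G$ is the algebra of invariants. Put $X_{x_k}=X_k$; $X_{x_k^T}=X_k^T$ if $G=O(n)$, $X_{x_k^T}=X_k^{*}$ if $G=Sp(n)$; and $X_{a_1\cdots a_r}=X_{a_1}\cdots X_{a_r}$. For an $n\times n$ matrix $X$, $\sigma_t(X)$ is defined by $\det(X+\lambda E)=\sum_{t=0}^n\lambda^{n-t}\sigma_t(X)$. The $\mathbb{F}$-algebra homomorphism $\Psi_n:\mathcal{N}_\sigma\to R^G$ is given by $\sigma_t(a)\mapsto\sigma_t(X_a)$ if $t\le n$ and $\sigma_t(a)\mapsto 0$ if $t>n$. Let $K_n=\ker\Psi_n$ and $K_\infty=\bigcap_n K_n$, over all admissible $n>0$. *)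

(* Defs.v *)
From HB Require Import structures.
From mathcomp Require Import all_boot all_order all_algebra.
From mathcomp Require Import finmap generic_quotient.
From mathcomp Require Import monalg mpoly.
From mathcomp Require Import boolp classical_sets cardinality.

Set Implicit Arguments.
Unset Strict Implicit.
Unset Printing Implicit Defensive.

Import GRing.Theory.
Local Open Scope ring_scope.
Local Open Scope quotient_scope.

Section Words.
Variable d : nat.

(* (k, false) is the letter x_k and (k, true) is the letter x_k^T. *)
Definition letter := ('I_d * bool)%type.

(* The free semigroup consists of the nonempty words; nonemptiness is imposed
   in [is_primitive], the empty word never enters otherwise. *)
Definition word := seq letter.

Definition trl (l : letter) : letter := (l.1, ~~ l.2).
Definition trw (a : word) : word := rev (map trl a).

Definition wpow (b : word) (k : nat) : word := flatten (nseq k b).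

Definition is_primitive (a : word) : Prop :=
  a <> [::] /\ forall (b : word) (k : nat), (size b < size a)%N -> a <> wpow b k.

Definition cyc_perm (a b : word) : Prop := exists k, b = rot k a.

Definition word_sim (a b : word) : Prop := cyc_perm a b \/ cyc_perm a (trw b).

Record primword :=
  PrimWord { pword :> word; _ : (fun a => `[< is_primitive a >]) pword }.
HB.instance Definition _ := [isSub for pword].
HB.instance Definition _ := [Choice of primword by <:].

Lemma primwordP (a : primword) : is_primitive a.
Proof. by apply/asboolP; apply: (valP a). Qed.

Lemma trlK : involutive trl.
Proof. by case=> i b; rewrite /trl /= negbK. Qed.

Lemma trwK : involutive trw.
Proof.
move=> a; rewrite /trw map_rev revK -map_comp -[RHS]map_id.
by apply: eq_map => l /=; rewrite trlK.
Qed.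

Lemma trw_rot k (a : word) : exists j, trw (rot k a) = rot j (trw a).
Proof.
by exists (size a - k)%N; rewrite /trw map_rot rev_rot /rotr size_rev size_map.
Qed.

Lemma cyc_perm_refl a : cyc_perm a a.
Proof. by exists 0%N; rewrite rot0. Qed.

Lemma cyc_perm_sym a b : cyc_perm a b -> cyc_perm b a.
Proof. by case=> k ->; exists (size (rot k a) - k)%N; rewrite -[LHS](rotK k). Qed.

Lemma cyc_perm_trans a b c : cyc_perm a b -> cyc_perm b c -> cyc_perm a c.
Proof.
by case=> k -> [j ->]; rewrite rot_rot_add; eexists.
Qed.

Lemma cyc_perm_trw a b : cyc_perm a b -> cyc_perm (trw a) (trw b).
Proof. by case=> k ->; have [j ->] := trw_rot k a; exists j. Qed.

Definition prim_sim (a b : primword) : bool := `[< word_sim a b >].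

Lemma prim_sim_refl : reflexive prim_sim.
Proof. by move=> a; apply/asboolP; left; apply: cyc_perm_refl. Qed.

Lemma prim_sim_sym : ssrbool.symmetric prim_sim.
Proof.
move=> a b; apply/idP/idP => /asboolP H; apply/asboolP.
all: case: H => H; [left; exact: cyc_perm_sym|right].
all: by apply: cyc_perm_sym; rewrite -[X in cyc_perm _ X]trwK; apply: cyc_perm_trw.
Qed.

Lemma prim_sim_trans : transitive prim_sim.
Proof.
move=> b a c /asboolP ab /asboolP bc; apply/asboolP.
case: ab bc => [ab|ab] [bc|bc].
- by left; apply: cyc_perm_trans bc.
- by right; apply: cyc_perm_trans bc.
- by right; apply: cyc_perm_trans ab _; apply: cyc_perm_trw.
- left; apply: cyc_perm_trans ab _; rewrite -[X in cyc_perm _ X]trwK.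
  exact: cyc_perm_trw.
Qed.

Canonical prim_sim_equiv := EquivRel prim_sim prim_sim_refl prim_sim_sym prim_sim_trans.

Definition primclass := {eq_quot prim_sim}.
HB.instance Definition _ := Choice.on primclass.

Definition generator : choiceType := ({t : nat | (0 < t)%N} * primclass)%type.

End Words.

(* The polynomial ring over F in the (infinitely many) generators. *)
Notation Nsigma F d := {malg F[{cmonom (generator d)}]}.

Definition nsigma (F : fieldType) (d : nat) (t : {t : nat | (0 < t)%N})
    (a : primword d) : Nsigma F d :=
  << ucm ((t, \pi_(primclass d) a) : generator d) >>.

(* Universal property of a polynomial ring in arbitrarily many variables:
   the F-algebra homomorphism sending the variable i to h i. *)
Section Evaluation.
Variables (F : fieldType) (I : choiceType) (S : comAlgType F) (h : I -> S).

Definition cmeval (m : {cmonom I}) : S := \prod_(i <- finsupp m) h i ^+ m i.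
Definition malg_eval : {malg F[{cmonom I}]} -> S :=
  monalg.mmap (in_alg S) cmeval.

Lemma cmevalEw (D : {fset I}) (m : {cmonom I}) : (finsupp m `<=` D)%fset ->
  cmeval m = \prod_(i <- D) h i ^+ m i.
Proof.
move=> sD; rewrite /cmeval; apply: big_fset_incl => // i _ /negP iNm.
by move: iNm; rewrite -cmE_neq0 => /negP; rewrite negbK => /eqP->.
Qed.

Lemma cmeval_mmorphism : monalg.mmorphism cmeval.
Proof.
split=> [m1 m2|]; last by rewrite /cmeval mdom1 big_seq_fset0.
rewrite (@cmevalEw (finsupp m1 `|` finsupp m2)%fset); last by rewrite mdomD.
rewrite (@cmevalEw (finsupp m1 `|` finsupp m2)%fset m1); last exact: fsubsetUl.
rewrite (@cmevalEw (finsupp m1 `|` finsupp m2)%fset m2); last exact: fsubsetUr.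
by rewrite -big_split /=; apply: eq_bigr => i _; rewrite cmM exprD.
Qed.

HB.instance Definition _ :=
  monalg.isMultiplicative.Build {cmonom I} S cmeval cmeval_mmorphism.

Lemma malg_eval_scalable : scalable malg_eval.
Proof. by move=> c g; rewrite /malg_eval monalg.mmapZ /= mulr_algl. Qed.

HB.instance Definition _ := GRing.RMorphism.copy malg_eval
  (monalg.mmap (in_alg S) cmeval).
HB.instance Definition _ :=
  GRing.isScalable.Build F {malg F[{cmonom I}]} S *:%R malg_eval malg_eval_scalable.

Lemma malg_evalX (i : I) : malg_eval << ucm i >> = h i.
Proof.
rewrite /malg_eval monalg.mmapU /= scale1r mul1r /cmeval mdomU big_seq_fset1.
by rewrite cmUU.
Qed.

Lemma malg_eval_fixed (phi : {lrmorphism S -> S}) :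
  (forall i, phi (h i) = h i) -> forall f, phi (malg_eval f) = malg_eval f.
Proof.
move=> phih f; rewrite /malg_eval /monalg.mmap raddf_sum.
apply: eq_bigr => m _; apply: etrans (rmorphM phi _ _) _; congr (_ * _).
  exact: rmorph_alg.
apply: etrans (rmorph_prod phi _ _ _) _; apply: eq_bigr => i _.
by apply: etrans (rmorphXn phi _ _) _; congr (_ ^+ _); apply: phih.
Qed.

End Evaluation.

Inductive classical_group := Orthogonal | Symplectic.

Definition admissible (G : classical_group) (n : nat) : bool :=
  if G is Symplectic then (0 < n)%N && ~~ odd n else (0 < n)%N.

Section Matrices.
Variable A : comNzRingType.

(* \det (X + lambda E) = \sum_(t <= n) lambda^(n - t) sigma_t(X); only used for
   t <= n, since the subtraction is truncated. *)
Definition msigma (n t : nat) (X : 'M[A]_n) : A :=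
  (\det (map_mx polyC X + 'X%:M))`_(n - t).

(* The matrix (0 E; -E 0), see [sympJ_block]; it is written entrywise because
   the size n is even but not syntactically of the form m + m. *)
Definition sympJ (n : nat) : 'M[A]_n :=
  \matrix_(i, j) ((j == i + n./2 :> nat)%N%:R - (i == j + n./2 :> nat)%N%:R).

(* The involution A^T (orthogonal case) or A^* = - J A^T J (symplectic case). *)
Definition invol (G : classical_group) (n : nat) (X : 'M[A]_n) : 'M[A]_n :=
  if G is Symplectic then - (sympJ n *m X^T *m sympJ n) else X^T.

Definition in_group (G : classical_group) (n : nat) (g : 'M[A]_n) : Prop :=
  g *m invol G g = 1%:M.

Lemma sympJ_block m : sympJ (m + m) = block_mx 0 1%:M (- 1%:M) 0.
Proof.
apply/matrixP => i j; have hm : (m + m)./2 = m by rewrite addnn doubleK.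
rewrite [LHS]mxE hm.
rewrite -(splitK i) -(splitK j); case: (split i) => k; case: (split j) => l /=.
- by rewrite block_mxEul mxE !ltn_eqF ?subrr // ltn_addl.
- rewrite block_mxEur mxE [in X in _ - X]ltn_eqF ?subr0; last first.
    by rewrite (leq_trans (ltn_ord k)) // leq_addl.
  by rewrite addnC eqn_add2r eq_sym.
- rewrite block_mxEdl !mxE [in X in X - _]ltn_eqF ?sub0r; last first.
    by rewrite (leq_trans (ltn_ord l)) // leq_addl.
  by rewrite addnC eqn_add2r.
- rewrite block_mxEdr mxE !ltn_eqF ?subrr // addnC ltn_add2r.
    by rewrite (leq_trans (ltn_ord k)) // leq_addr.
  by rewrite (leq_trans (ltn_ord l)) // leq_addr.
Qed.

Lemma tr_sympJ n : (sympJ n)^T = - sympJ n.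
Proof. by apply/matrixP => i j; rewrite !mxE opprB. Qed.

Lemma sympJ_sqr n : ~~ odd n -> sympJ n *m sympJ n = - 1%:M.
Proof.
move=> /negbTE en; have := odd_double_half n; rewrite en add0n -addnn => <-.
move: n./2 => m; rewrite sympJ_block mulmx_block !mul0mx !mulmx0 !mul1mx !mulmx1.
by rewrite !add0r !addr0 (@scalar_mx_block _ m m) opp_block_mx !oppr0.
Qed.

Lemma admissible_even n : admissible Symplectic n -> ~~ odd n.
Proof. by case/andP. Qed.

Lemma involM G n (X Y : 'M[A]_n) : admissible G n ->
  invol G (X *m Y) = invol G Y *m invol G X.
Proof.
case: G => [_|/admissible_even en]; first exact: trmx_mul.
rewrite /invol mulNmx mulmxN opprK trmx_mul !mulmxA.
rewrite -(mulmxA _ (sympJ n) (sympJ n)) sympJ_sqr //.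
by rewrite mulmxN mulmx1 !mulNmx.
Qed.

Lemma involK G n (X : 'M[A]_n) : admissible G n -> invol G (invol G X) = X.
Proof.
case: G => [_|/admissible_even en]; first exact: trmxK.
rewrite /invol linearN /= !trmx_mul trmxK tr_sympJ.
rewrite mulmxN !mulNmx !mulmxN !mulNmx !opprK !mulmxA sympJ_sqr //.
by rewrite -mulmxA sympJ_sqr // mulmxN mulmx1 !mulNmx mul1mx opprK.
Qed.

Lemma invol1 G n : admissible G n -> invol G (1%:M : 'M[A]_n) = 1%:M.
Proof.
case: G => [_|/admissible_even en]; first exact: trmx1.
by rewrite /invol trmx1 mulmx1 sympJ_sqr // opprK.
Qed.

Lemma msigma_mulC n t (X Y : 'M[A]_n) : msigma t (X *m Y) = msigma t (Y *m X).
Proof.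
rewrite /msigma; congr ((_ : {poly A})`_ _); rewrite !map_mxM /=.
move: (map_mx _ X) (map_mx _ Y) => {X Y} X Y.
pose M := block_mx ('X%:M) X (- Y) (1%:M : 'M[{poly A}]_n).
have e1 : \det M = \det (X *m Y + 'X%:M).
  have : \det (M *m block_mx 1%:M 0 Y 1%:M) = \det (X *m Y + 'X%:M).
    rewrite mulmx_block !mulmx1 !mulmx0 !add0r mul1mx addNr det_ublock det1 mulr1.
    by rewrite addrC.
  by rewrite det_mulmx det_lblock !det1 !mulr1.
have e2 : 'X^n * \det M = 'X^n * \det (Y *m X + 'X%:M).
  have : \det (block_mx 1%:M 0 Y 'X%:M *m M) = 'X^n * \det (Y *m X + 'X%:M).
    rewrite mulmx_block !mul1mx !mul0mx !addr0 mulmx1.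
    rewrite mulmxN scalar_mxC subrr det_ublock det_scalar.
    by rewrite ?addr0.
  by rewrite det_mulmx det_lblock det1 mul1r det_scalar.
rewrite -e1; apply/polyP => i; have := congr1 (fun p : {poly A} => p`_(i + n)) e2.
by rewrite !coefXnM ltnNge leq_addl /= addnK.
Qed.

Lemma msigma_invol G n t (X : 'M[A]_n) : admissible G n ->
  msigma t (invol G X) = msigma t X.
Proof.
have tr Z : msigma t (Z^T : 'M[A]_n) = msigma t Z.
  by rewrite /msigma -[in RHS]det_tr linearD /= tr_scalar_mx map_trmx.
case: G => [_|/admissible_even en]; rewrite /invol ?tr //.
rewrite -mulmxA -mulNmx msigma_mulC -mulmxA mulmxN sympJ_sqr // opprK.
by rewrite mulmx1 tr.
Qed.

End Matrices.

Lemma map_sympJ (A B : comNzRingType) (f : {rmorphism A -> B}) n :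
  map_mx f (sympJ A n) = sympJ B n.
Proof. by apply/matrixP => i j; rewrite !mxE rmorphB !rmorph_nat. Qed.

Lemma map_invol (A B : comNzRingType) (f : {rmorphism A -> B}) G n (X : 'M_n) :
  map_mx f (invol G X) = invol G (map_mx f X).
Proof.
case: G; rewrite /invol -?map_trmx //.
by rewrite map_mxN !map_mxM /= map_sympJ -map_trmx.
Qed.

Lemma map_msigma (A B : comNzRingType) (f : {rmorphism A -> B}) n t (X : 'M_n) :
  f (msigma t X) = msigma t (map_mx f X).
Proof.
rewrite /msigma -coef_map /= -det_map_mx map_mxD /= map_scalar_mx /= map_polyX.
congr ((\det (_ + _) : {poly B})`_ _).
by apply/matrixP => i j; rewrite !mxE map_polyC.
Qed.

Section Invariants.
Variables (F : fieldType) (d : nat) (G : classical_group) (n : nat).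

Definition nvars := #|{: 'I_n * 'I_n * 'I_d}|.

(* R = F[x_ij(k)] *)
Notation R := {mpoly F[nvars]}.

Definition genericX (k : 'I_d) : 'M[R]_n :=
  \matrix_(i, j) 'X_(enum_rank (i, j, k)).

Definition letterX (l : letter d) : 'M[R]_n :=
  if l.2 then invol G (genericX l.1) else genericX l.1.

Definition wordX (a : word d) : 'M[R]_n := \prod_(l <- a) letterX l.

(* g sends x_ij(k) to the (i,j) entry of g^-1 X_k g. *)
Definition act_image (g : 'M[F]_n) : nvars.-tuple R :=
  [tuple let: (i, j, k) := enum_val m in
     (map_mx (@mpolyC nvars F) (invmx g) *m genericX k
        *m map_mx (@mpolyC nvars F) g) i j | m < nvars].

Definition act (g : 'M[F]_n) (f : R) : R := f \mPo act_image g.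
HB.instance Definition _ g :=
  GRing.LRMorphism.copy (act g) (comp_mpoly (act_image g)).

Definition invariants : set R :=
  [set f | forall g : 'M[F]_n, in_group G g -> act g f = f]%classic.

Definition psi_gen (s : generator d) : R :=
  if (sval s.1 <= n)%N then msigma (sval s.1) (wordX (repr s.2)) else 0.

Definition Psi : Nsigma F d -> R := malg_eval psi_gen.
HB.instance Definition _ := GRing.LRMorphism.copy Psi (malg_eval psi_gen).

Definition Kn : set (Nsigma F d) := [set f | Psi f = 0]%classic.

(* Psi does not depend on the representatives chosen by [repr], and takes its
   values in the algebra of invariants. *)

Lemma wordX_nil : wordX [::] = 1%:M.
Proof. exact: big_nil. Qed.

Lemma wordX_cons l a : wordX (l :: a) = letterX l *m wordX a.
Proof. exact: big_cons. Qed.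

Lemma wordX_seq1 l : wordX [:: l] = letterX l.
Proof. by rewrite wordX_cons wordX_nil mulmx1. Qed.

Lemma letterX_trl l : admissible G n -> letterX (trl l) = invol G (letterX l).
Proof. by move=> adm; case: l => k [] //; rewrite /letterX /= involK. Qed.

Lemma wordX_cat a b : wordX (a ++ b) = wordX a *m wordX b.
Proof. exact: big_cat. Qed.

Lemma wordX_trw a : admissible G n -> wordX (trw a) = invol G (wordX a).
Proof.
move=> adm; elim: a => [|l a IH]; first by rewrite wordX_nil invol1.
have -> : trw (l :: a) = trw a ++ [:: trl l] by rewrite /trw /= rev_cons cats1.
by rewrite wordX_cat IH wordX_seq1 wordX_cons (involM _ _ adm) (letterX_trl _ adm).
Qed.

Lemma msigma_wordX_sim t a b : admissible G n -> word_sim a b ->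
  msigma t (wordX a) = msigma t (wordX b).
Proof.
move=> adm.
have cyc c e : cyc_perm c e -> msigma t (wordX c) = msigma t (wordX e).
  case=> k ->; rewrite /rot wordX_cat msigma_mulC -wordX_cat.
  by rewrite cat_take_drop.
case=> [ab|ab]; first exact: cyc.
rewrite (cyc _ _ ab).
rewrite (wordX_trw _ adm).
exact: msigma_invol.
Qed.

Lemma Psi_nsigma t (a : primword d) : admissible G n ->
  Psi (nsigma F t a) = if (sval t <= n)%N then msigma (sval t) (wordX a) else 0.
Proof.
move=> adm.
have -> : Psi (nsigma F t a) = psi_gen (t, \pi_(primclass d) a).
  exact: malg_evalX.
rewrite /psi_gen; cbn [fst snd]; case: (sval t <= n)%N; last exact: erefl.
apply: (msigma_wordX_sim _ adm).
apply/asboolP.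
have : repr (\pi_(primclass d) a) = a %[mod primclass d] by rewrite reprK.
by move/eqmodP.
Qed.

Lemma map_act_genericX g k : map_mx (act g) (genericX k) =
  map_mx (@mpolyC nvars F) (invmx g) *m genericX k *m map_mx (@mpolyC nvars F) g.
Proof.
apply/matrixP => i j; rewrite mxE [X in act g X]mxE /act comp_mpolyXU.
by rewrite -tnth_nth tnth_mktuple enum_rankK.
Qed.

Lemma conj_mulmx (A : comNzRingType) (P Q X Y : 'M[A]_n) : P *m Q = 1%:M ->
  Q *m X *m P *m (Q *m Y *m P) = Q *m (X *m Y) *m P.
Proof.
by move=> PQ; rewrite !mulmxA -(mulmxA _ P Q) PQ mulmx1.
Qed.

Lemma Psi_invariants f : admissible G n -> invariants (Psi f).
Proof.
move=> adm g gG.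
have gi : map_mx (@mpolyC nvars F) (invmx g) = invol G (map_mx (@mpolyC nvars F) g).
  rewrite -map_invol; congr map_mx; case: (mulmx1_unit gG) => gu _.
  by rewrite -[invmx g]mulmx1 -gG mulKmx.
have gg : map_mx (@mpolyC nvars F) g *m invol G (map_mx (@mpolyC nvars F) g) = 1%:M.
  by rewrite -map_invol -map_mxM gG map_mx1.
have actXk k : map_mx (act g) (genericX k) =
    invol G (map_mx (@mpolyC nvars F) g) *m genericX k *m map_mx (@mpolyC nvars F) g.
  by rewrite -gi; apply: map_act_genericX.
move: gg actXk {gi}; move: (map_mx (@mpolyC nvars F) g) => P gg actXk.
have actXl l : map_mx (act g) (letterX l) = invol G P *m letterX l *m P.
  case: l => k []; rewrite /letterX; cbn [fst snd]; last exact: actXk.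
  rewrite map_invol actXk (involM _ _ adm) (involM _ _ adm) (involK _ adm).
  exact: mulmxA.
have actXw a : map_mx (act g) (wordX a) = invol G P *m wordX a *m P.
  elim: a => [|l a IH].
    by rewrite wordX_nil map_mx1 mulmx1 (mulmx1C gg).
  rewrite !wordX_cons map_mxM actXl IH; exact: conj_mulmx.
apply: (malg_eval_fixed (phi := act g)) => s.
rewrite /psi_gen; case: (sval s.1 <= n)%N; last exact: rmorph0.
rewrite map_msigma actXw -mulmxA msigma_mulC -mulmxA gg mulmx1.
exact: erefl.
Qed.

End Invariants.

Arguments Kn F d G n : clear implicits.

Definition Kinfty (F : fieldType) (d : nat) (G : classical_group) :
    set (Nsigma F d) :=
  (\bigcap_(n in [set n | admissible G n]) Kn F d G n)%classic.

Arguments Kinfty F d G : clear implicits.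

(* Main.v *)
Require Import Defs.
From mathcomp Require Import all_boot all_order all_algebra.
From mathcomp Require Import fingroup perm.
From mathcomp Require Import finmap generic_quotient.
From mathcomp Require Import monalg mpoly.
From mathcomp Require Import boolp classical_sets cardinality.
From mathcomp Require Import zify.

(* Over a ring containing a square root of -1, the form on W + W^* is
   hyperbolic in both the orthogonal and the symplectic case; for block
   diagonal X_k, the letters x_k and x_k^T act on W by 2d unrelated matrices
   Y_l, and X_a is the direct sum of Y_a and of the transpose of Y_{a^T}.

   Take for Y a direct sum of weighted directed cycles labelled by primitive
   words: on a cycle labelled [a] whose closing edge has weight z, the
   characteristic polynomial of Y_b acquires the root -z if b is a cyclic
   permutation of a, and is a power of the variable otherwise. With several
   cycles for each of the finitely many classes occurring in f, the
   characteristic polynomial of X_a is thus prescribed by the weights, freely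
   and independently for the different classes, up to the squaring that occurs
   when a^T is a cyclic permutation of a (2 is invertible, so square roots of
   monic polynomials exist in high degrees).

   The coefficients are prescribed to be the generators sigma_t(a) themselves:
   over a ring extension of N_sigma where the required polynomials split, this
   gives a specialization of R sending Psi_n(f) to f. *)

Set Implicit Arguments.
Unset Strict Implicit.
Unset Printing Implicit Defensive.

Import GRing.Theory.
Local Open Scope ring_scope.

(** * Primitive words *)

Lemma size_wpow d (b : word d) k : size (wpow b k) = (k * size b)%N.
Proof. by elim: k => [|k IH] //; rewrite size_cat [size (flatten _)]IH. Qed.

Lemma nth_wpow d (b : word d) k j x0 : (j < k * size b)%N ->
  nth x0 (wpow b k) j = nth x0 b (j %% size b).
Proof.
elim: k j => [|k IH] j //; rewrite mulSn => hj; rewrite nth_cat.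
case: ltnP => hb; first by rewrite modn_small.
rewrite -[in RHS](subnK hb) modnDr; apply: IH.
by rewrite ltn_subLR.
Qed.

Lemma is_primitive_trw d (a : word d) : is_primitive a -> is_primitive (trw a).
Proof.
have wpowSr (b : word d) k : wpow b k.+1 = wpow b k ++ b.
  by elim: k => [|k IH]; rewrite /wpow /= ?cats0 // -catA; congr (_ ++ _).
have trw_wpow (b : word d) k : trw (wpow b k) = wpow (trw b) k.
  elim: k => // k IH; rewrite wpowSr [RHS]/wpow /= -/(wpow _ k) -IH.
  by rewrite /trw map_cat rev_cat.
case=> a0 ap; split=> [E|b k].
  by apply: a0; rewrite -[a]trwK E.
rewrite /trw size_rev size_map => hb E.
apply: (ap (trw b) k); first by rewrite /trw size_rev size_map.
by rewrite -trw_wpow -E -/(trw a) trwK.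
Qed.

Lemma periodic_mul (T : Type) (w : nat -> T) p :
  (forall j, w (j + p)%N = w j) -> forall k j, w (j + k * p)%N = w j.
Proof.
by move=> wp; elim=> [|k IH] j; rewrite ?addn0 // mulSnr addnA wp IH.
Qed.

(** Otherwise [a] would be a proper power of its prefix of length [g]. *)
Lemma primitive_period d (a : word d) (w : nat -> letter d) (g : nat) x0 :
  is_primitive a -> (0 < g)%N -> (g %| size a)%N ->
  (forall j, w (j + g)%N = w j) -> (forall j, nth x0 a (j %% size a) = w j) ->
  g = size a.
Proof.
move=> [a0 ap] g0 ga wg aw.
have s0 : (0 < size a)%N by case: (a) a0.
have gle : (g <= size a)%N by rewrite dvdn_leq.
apply/eqP; rewrite eqn_leq gle leqNgt; apply/negP => glt.
have st : size (take g a) = g by rewrite size_takel.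
apply: (ap (take g a) (size a %/ g)%N); first by rewrite st.
have ss : size (wpow (take g a) (size a %/ g)%N) = size a.
  by rewrite size_wpow st divnK.
apply: (@eq_from_nth _ x0) => // j hj.
rewrite nth_wpow ?st ?divnK // nth_take ?ltn_mod //.
rewrite -[j in LHS](modn_small hj) aw {1}(divn_eq j g) addnC periodic_mul //.
rewrite -aw modn_small //.
exact: leq_trans (ltn_pmod _ g0) gle.
Qed.

(** Bezout in the form [u * p = v * q + gcdn p q] needs only forward shifts. *)
Lemma period_gcd (T : Type) (w : nat -> T) p q : (0 < p)%N ->
  (forall j, w (j + p)%N = w j) -> (forall j, w (j + q)%N = w j) ->
  forall j, w (j + gcdn p q)%N = w j.
Proof.
move=> p0 wp wq j.
case: (egcdnP q p0) => u v E _.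
rewrite -(periodic_mul wq v (j + _)%N) -addnA [(gcdn _ _ + _)%N]addnC -E.
exact: periodic_mul.
Qed.

(* If the powers of [b] can be read along the periodic continuation of [a]
   from position [i], this continuation has the periods [size a] and [size b],
   hence their gcd, which primitivity forces to be both sizes. *)
Lemma primitive_match d (a b : word d) (i : nat) x0 :
  is_primitive a -> is_primitive b -> (i < size a)%N ->
  (forall k s, (s < size b)%N ->
     nth x0 b s = nth x0 a ((i + k * size b + s) %% size a)) ->
  b = rot i a.
Proof.
move=> pa pb ia H.
have a0 : (0 < size a)%N by apply: leq_trans ia.
have b0 : (0 < size b)%N by case: pb; case: (b).
pose w j := nth x0 a ((i + j) %% size a).
have wb j : nth x0 b (j %% size b) = w j.
  rewrite (H (j %/ size b)%N) ?ltn_mod // -addnA -divn_eq //.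
have pera j : w (j + size a)%N = w j by rewrite /w addnA modnDr.
have perb j : w (j + size b)%N = w j by rewrite -!wb modnDr.
have perg := period_gcd a0 pera perb.
have g0 : (0 < gcdn (size a) (size b))%N by rewrite gcdn_gt0 a0.
have gb := primitive_period pb g0 (dvdn_gcdr _ _) perg wb.
pose w' j := nth x0 a (j %% size a).
(* [w'] is [w] read from offset [size a - i], so it inherits the gcd as a period. *)
have w'E j : w' j = w (j + (size a - i))%N.
  by rewrite /w' /w addnCA subnKC ?modnDr // ltnW.
have perg' j : w' (j + gcdn (size a) (size b))%N = w' j.
  by rewrite !w'E addnAC perg.
have ga := primitive_period pa g0 (dvdn_gcdl _ _) perg' (fun j => erefl).
have sab : size a = size b by rewrite -ga gb.
apply: (@eq_from_nth _ x0) => [|j hj]; first by rewrite size_rot.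
rewrite -[j in LHS](modn_small hj) wb /w /rot nth_cat size_drop.
rewrite sab in ia *.
case: ltnP => hji.
  by rewrite nth_drop modn_small // -ltn_subRL.
rewrite nth_take; last by rewrite ltn_subLR // subnK // ltnW.
congr nth; have -> : (i + j = (j - (size b - i)) + size b)%N.
  by rewrite -[in LHS](subnK hji) addnCA subnKC // ltnW.
rewrite modnDr modn_small // ltn_subLR //.
by apply: leq_trans hj _; rewrite leq_addl.
Qed.

(** Equal rotations give the periodic continuation of [a] the period [j - i]. By primitivity its gcd
    with [size a] is [size a]; as [j - i < size a], only [j - i = 0] is left. *)
Lemma primitive_rot_inj d (a : word d) i j : is_primitive a ->
  (i < size a)%N -> (j < size a)%N -> rot i a = rot j a -> i = j.
Proof.
wlog ij : i j / (i <= j)%N => [W|].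
  by case/orP: (leq_total i j) => h pa hi hj E; [|apply/esym]; apply: W.
move=> pa hi hj E.
have [x0 _] : {x0 : letter d | True} by case: (a) hi => [|x s] //; exists x.
pose w j := nth x0 a (j %% size a).
have rotE k m : (k < size a)%N -> (m < size a)%N ->
    nth x0 (rot k a) m = w (k + m)%N.
  move=> hk hm; rewrite /w /rot nth_cat size_drop; case: ltnP => h.
    by rewrite nth_drop modn_small // -ltn_subRL.
  rewrite nth_take; last by rewrite ltn_subLR // subnK // ltnW.
  congr nth; have -> : (k + m = (m - (size a - k)) + size a)%N.
    by rewrite -[in LHS](subnK h) addnCA subnKC // ltnW.
  rewrite modnDr modn_small // ltn_subLR //.
  by apply: leq_trans hm _; rewrite leq_addl.
have a0 : (0 < size a)%N by apply: leq_trans hi.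
have wa k : w (k + size a)%N = w k by rewrite /w modnDr.
have wij k : w (k + (j - i))%N = w k.
  have wmod m : w m = w (m %% size a)%N by rewrite /w modn_mod.
  have -> : w k = w (i + (k + (size a - i)) %% size a)%N.
    by rewrite [RHS]wmod modnDmr -wmod -[LHS]wa; congr w; lia.
  rewrite -(rotE i) ?ltn_mod // E rotE ?ltn_mod //.
  rewrite [RHS]wmod modnDmr -wmod -[LHS]wa; congr w; lia.
case: (posnP (j - i)) => [/eqP h|ji0].
  by apply/eqP; rewrite eqn_leq ij -subn_eq0.
have g0 : (0 < gcdn (size a) (j - i))%N by rewrite gcdn_gt0 a0.
have h := primitive_period pa g0 (dvdn_gcdl _ _) (period_gcd a0 wa wij)
  (fun=> erefl).
have := dvdn_gcdr (size a) (j - i); rewrite h => /(dvdn_leq ji0).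
by rewrite leqNgt (leq_ltn_trans (leq_subr _ _) hj).
Qed.

(** * Ring extensions *)

(** The root is the class of the variable in A[X]/(p); constants are already reduced modulo a monic
    [p] of positive degree, so [A] embeds. *)
Lemma adjoin_root (A : comNzRingType) (p : {poly A}) :
  p \is monic -> (1 < size p)%N ->
  exists (B : comNzRingType) (f : {rmorphism A -> B}),
    injective f /\ exists x, root (map_poly f p) x.
Proof.
move=> pm sp; pose f : {rmorphism A -> {poly %/ p}} := in_qpoly p \o polyC.
have mE : mk_monic p = p by rewrite /mk_monic sp pm.
exists {poly %/ p}, f; split=> [a b E|].
  have sC c : (size (c%:P : {poly A}) < size (mk_monic p))%N.
    by rewrite mE (leq_ltn_trans (size_polyC_leq1 _)).
  apply: polyC_inj; rewrite -(in_qpoly_small (sC a)) -(in_qpoly_small (sC b)).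
  by have -> : in_qpoly p a%:P = in_qpoly p b%:P by exact: E.
exists (in_qpoly p 'X); rewrite /root map_poly_comp horner_map /=.
rewrite -/(comp_poly 'X p) comp_polyXr.
by apply/eqP/val_inj => /=; rewrite mE Pdiv.RingMonic.rmodpp.
Qed.

(** Linear factors carry a plus sign to agree with [charpoly]; hence [z] collects the negatives of
    the roots. *)
Lemma split_poly (A : comNzRingType) (p : {poly A}) : p \is monic ->
  exists (B : comNzRingType) (f : {rmorphism A -> B}),
    injective f /\ exists z : seq B, map_poly f p = \prod_(x <- z) ('X + x%:P).
Proof.
have [n] := ubnP (size p); elim: n => // n IH in A p *.
rewrite ltnS => sn pm; case: (leqP (size p) 1) => sp.
  have -> : p = 1.
    by move: pm; rewrite (size1_polyC sp) monicE lead_coefC => /eqP->.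
  by exists A, idfun; split=> //; exists [::]; rewrite big_nil rmorph1.
have [B [f [fi [x /factor_theorem [q E]]]]] := adjoin_root pm sp.
have qm : q \is monic.
  by rewrite -(monicMr _ (monicXsubC x)) -E monic_map.
have sq : (size q < n)%N.
  apply: leq_trans sn; rewrite -(size_map_inj_poly fi) ?rmorph0 // E.
  by rewrite size_Mmonic ?monic_neq0 ?monicXsubC // size_XsubC addn2.
have [C [g [gi [z Ez]]]] := IH _ _ sq qm.
exists C, (g \o f : {rmorphism _ -> _}); split; first exact: inj_comp.
exists (- g x :: z); rewrite big_cons -Ez map_poly_comp E rmorphM /=.
by rewrite mulrC map_polyXsubC polyCN.
Qed.

Lemma split_polys (A : comNzRingType) (T : eqType) (s : seq T)
    (p : T -> {poly A}) : (forall c, p c \is monic) ->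
  exists (B : comNzRingType) (f : {rmorphism A -> B}),
    injective f /\ exists z : T -> seq B,
      forall c, c \in s -> map_poly f (p c) = \prod_(x <- z c) ('X + x%:P).
Proof.
elim: s => [|c s IH] in A p * => pm.
  by exists A, idfun; split=> //; exists (fun=> [::]).
have [B [f [fi [z0 E0]]]] := split_poly (pm c).
have [|C [g [gi [z E]]]] := IH B (map_poly f \o p).
  by move=> e; apply: monic_map.
exists C, (g \o f : {rmorphism _ -> _}); split; first exact: inj_comp.
exists (fun e => if e == c then map g z0 else z e) => e.
rewrite inE map_poly_comp; case: eqP => [-> _|_ /= es]; last exact: E.
rewrite E0 rmorph_prod big_map; apply: eq_bigr => x _.
by rewrite rmorphD /= map_polyX map_polyC.
Qed.

Lemma adjoin_sqrtN1 (A : comNzRingType) :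
  exists (B : comNzRingType) (f : {rmorphism A -> B}),
    injective f /\ exists i, i * i = - 1 :> B.
Proof.
have sX : size ('X^2 + 1 : {poly A}) = 3%N.
  by rewrite size_polyDl size_polyXn // size_poly1.
have [||B [f [fi [x /rootP E]]]] := @adjoin_root A ('X^2 + 1).
- by rewrite monicE lead_coefDl ?lead_coefXn // size_polyXn size_poly1.
- by rewrite sX.
exists B, f; split=> //; exists x; apply/eqP; rewrite -addr_eq0 -E.
by rewrite rmorphD /= map_polyXn rmorph1 hornerD hornerXn hornerC.
Qed.

(** * Matrices of weighted cycles *)

Section WordMatrix.
Variables (d : nat) (A : comNzRingType).
Implicit Types (a b : word d) (l : letter d).

(** With the sign convention of [msigma], sigma_t is the coefficient in degree [n - t], and an
    eigenvalue [z] gives the factor ['X + z%:P]. *)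
Definition charpoly n (M : 'M[A]_n) : {poly A} :=
  \det (map_mx polyC M + 'X%:M).

Definition mxword n (Y : letter d -> 'M[A]_n) b : 'M[A]_n := \prod_(l <- b) Y l.

Lemma mxword_nil n (Y : letter d -> 'M[A]_n) : mxword Y [::] = 1%:M.
Proof. exact: big_nil. Qed.

Lemma mxword_cons n (Y : letter d -> 'M[A]_n) l b :
  mxword Y (l :: b) = Y l *m mxword Y b.
Proof. exact: big_cons. Qed.

Lemma mxword_cat n (Y : letter d -> 'M[A]_n) a b :
  mxword Y (a ++ b) = mxword Y a *m mxword Y b.
Proof. exact: big_cat. Qed.

Lemma mxword_rev_tr n (Y Z : letter d -> 'M[A]_n) b :
  (forall l, Z l = (Y (trl l))^T) -> mxword Z b = (mxword Y (trw b))^T.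
Proof.
move=> ZY; elim: b => [|l b IH]; first by rewrite !mxword_nil trmx1.
have -> : trw (l :: b) = trw b ++ [:: trl l] by rewrite /trw /= rev_cons cats1.
by rewrite mxword_cat !mxword_cons mxword_nil mulmx1 trmx_mul -IH ZY.
Qed.

Lemma mxword_block m n (Y : letter d -> 'M[A]_m) (Z : letter d -> 'M[A]_n) b :
  mxword (fun l => block_mx (Y l) 0 0 (Z l)) b =
  block_mx (mxword Y b) 0 0 (mxword Z b).
Proof.
elim: b => [|l b IH]; first by rewrite !mxword_nil -scalar_mx_block.
by rewrite !mxword_cons IH mulmx_block !mulmx0 !mul0mx !addr0 !add0r.
Qed.

Lemma charpoly_block m n (M : 'M[A]_m) (N : 'M[A]_n) :
  charpoly (block_mx M 0 0 N) = charpoly M * charpoly N.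
Proof.
rewrite /charpoly map_block_mx !map_mx0 scalar_mx_block add_block_mx !addr0.
exact: det_ublock.
Qed.

Lemma charpoly_tr n (M : 'M[A]_n) : charpoly M^T = charpoly M.
Proof. by rewrite /charpoly -[RHS]det_tr linearD /= tr_scalar_mx map_trmx. Qed.

Lemma charpoly0 n : charpoly (0 : 'M[A]_n) = 'X^n.
Proof. by rewrite /charpoly map_mx0 add0r det_scalar. Qed.

(* The weighted adjacency matrix of the edges labelled [l] in a directed cycle
   labelled [a]; the weight [z] sits on the edge closing the cycle. *)
Definition cycle_mx a (z : A) l : 'M[A]_(size a) :=
  \matrix_(i, j) if (j == i.+1 %% size a :> nat)%N && (nth l a i == l)
                 then z ^+ (i.+1 %/ size a) else 0.

(** Whether [b] labels a walk along the cycle from vertex [k]. The default [l] of [nth] would count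
    as a match, but is never reached for nonempty [a]. *)
Fixpoint reads a b (k : nat) : bool :=
  if b is l :: b' then (nth l a (k %% size a) == l) && reads a b' k.+1
  else true.

Lemma reads_mod a b k : reads a b (k %% size a) = reads a b k.
Proof.
elim: b k => //= l b IH k; rewrite modn_mod; congr (_ && _).
by rewrite -IH -[in LHS]addn1 modnDml addn1 IH.
Qed.

Lemma readsP a b k x0 : (0 < size a)%N -> reads a b k ->
  forall s, (s < size b)%N -> nth x0 b s = nth x0 a ((k + s) %% size a).
Proof.
move=> a0; elim: b k => //= l b IH k /andP[/eqP lk bk] [|s] hs /=.
  by rewrite addn0 -lk; apply: set_nth_default; rewrite ltn_mod.
by rewrite addnS -addSn; apply: IH.
Qed.

Lemma reads_rot a k : (k < size a)%N -> reads a (rot k a) k.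
Proof.
move=> ka; have aux b j : (forall x0 s, (s < size b)%N ->
    nth x0 b s = nth x0 a ((j + s) %% size a)) -> reads a b j.
  elim: b j => //= l b IH j H.
  rewrite -[X in nth l a (X %% _)](addn0 j) -H //= eqxx.
  by apply: IH => x0 s hs; rewrite addSnnS -(H x0 s.+1).
apply: aux => x0 s; rewrite size_rot => hs; rewrite /rot nth_cat size_drop.
case: ltnP => h; first by rewrite nth_drop modn_small // -ltn_subRL.
rewrite nth_take; last by rewrite ltn_subLR // subnK // ltnW.
have -> : (k + s = (s - (size a - k)) + size a)%N by lia.
by rewrite modnDr modn_small //; lia.
Qed.

(** At most one walk spelling [b] leaves [i]; the exponent counts its passages through the closing
    edge. *)
Lemma mxword_cycleE a z b (i j : 'I_(size a)) :
  mxword (cycle_mx a z) b i j =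
  if (j == (i + size b) %% size a :> nat)%N && reads a b i
  then z ^+ ((i + size b) %/ size a) else 0.
Proof.
elim: b i => [|l b IH] i.
  rewrite mxword_nil mxE addn0 modn_small // divn_small // andbT expr0.
  by rewrite eq_sym val_eqE; case: eqP.
have a0 : (0 < size a)%N := leq_ltn_trans (leq0n _) (ltn_ord i).
pose i1 : 'I_(size a) := Ordinal (ltn_pmod i.+1 a0).
rewrite mxword_cons mxE (bigD1 i1) //= big1 ?addr0 => [|k ki1]; last first.
  by rewrite mxE -[k == _ :> nat]/(k == i1) (negbTE ki1) mul0r.
rewrite mxE eqxx /= IH /= reads_mod modnDml addSnnS (modn_small (ltn_ord i)).
case: (nth l a i == l) => /=; last by rewrite mul0r andbF.
case: ifP => _; last by rewrite mulr0.
rewrite -exprD; congr (_ ^+ _).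
by rewrite -addSnnS [in RHS](divn_eq i.+1 (size a)) -addnA divnMDl.
Qed.

(** A rotation of [a] closes up after one turn, so its matrix is diagonal with [z] at a single
    vertex. Otherwise no closed walk reads powers of [b], and only the identity permutation survives
    in the determinant. The factor ['X] avoids the exponent [size a - 1]. *)
Lemma charpoly_cycle a z b : is_primitive a -> is_primitive b ->
  if `[< cyc_perm a b >]
  then charpoly (mxword (cycle_mx a z) b) * 'X = 'X^(size a) * ('X + z%:P)
  else charpoly (mxword (cycle_mx a z) b) = 'X^(size a).
Proof.
move=> pa pb; have a0 : (0 < size a)%N by case: pa; case: (a).
have [x0 _] : {x0 : letter d | True} by case: (a) a0 => [|x s] //; exists x.
case: asboolP => [[k0 bk0]|nab].
  have [k [ka bk]] : exists k, (k < size a)%N /\ b = rot k a.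
    case: (ltnP k0 (size a)) => h; first by exists k0.
    by exists 0%N; rewrite rot0 bk0 rot_oversize.
  have sb : size b = size a by rewrite bk size_rot.
  pose D : 'rV[{poly A}]_(size a) :=
    \row_i ('X + (if i == k :> nat then z%:P else 0)).
  have -> : charpoly (mxword (cycle_mx a z) b) = \det (diag_mx D).
    congr (\det _); apply/matrixP => i j; rewrite !mxE mxword_cycleE sb modnDr.
    rewrite modn_small //; case: (eqVneq i j) => [<-|ij]; last first.
      by rewrite val_eqE eq_sym (negbTE ij) addr0.
    rewrite eqxx addrC !mulr1n; congr (_ + _).
    rewrite divnDr // divnn a0 divn_small // expr1 bk.
    case: eqP => [->|ik]; first by rewrite reads_rot.
    case: ifP => // ri; case: ik; apply: (primitive_rot_inj pa) => //.
    rewrite -bk; apply/esym; rewrite -bk in ri.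
    apply: (primitive_match (x0 := x0)) => // m s hs.
    rewrite (readsP x0 a0 ri) // sb addnAC [in RHS]addnC modnMDl //.
  rewrite det_diag (bigD1 (Ordinal ka)) //= mxE eqxx.
  rewrite (eq_bigr (fun=> 'X)) => [|i ik]; last first.
    by rewrite mxE -[i == k :> nat]/(i == Ordinal ka) (negbTE ik) addr0.
  by rewrite prodr_const cardC1 card_ord -mulrA -exprSr prednK // mulrC.
have nread (i : nat) : (i < size a)%N ->
    (forall k, reads a b ((i + k * size b) %% size a)) -> False.
  move=> hi H; apply: nab; exists i.
  apply: (primitive_match (x0 := x0)) => // k s hs.
  have := H k; rewrite reads_mod => /(readsP x0 a0) -> //.
pose M := mxword (cycle_mx a z) b.
have Mne i j : M i j != 0 ->
    (j = (i + size b) %% size a :> nat)%N /\ reads a b i.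
  by rewrite /M mxword_cycleE; case: ifP => [/andP[/eqP]|]; rewrite ?eqxx.
have M0 i : M i i = 0.
  apply/eqP/negP => /negP/Mne [E r]; apply: (nread i) => // k.
  have -> : ((i + k * size b) %% size a = i)%N; last exact: r.
  elim: k => [|k IH]; first by rewrite addn0 modn_small.
  by rewrite mulSnr addnA -modnDml IH -E.
rewrite /charpoly /determinant (bigD1 (1%g : 'S_(size a))) //=.
rewrite [X in _ + X]big1 ?addr0 => [|s s1].
  rewrite odd_perm1 expr0 mul1r (eq_bigr (fun=> 'X)) => [|i _].
    by rewrite prodr_const card_ord.
  by rewrite perm1 !mxE -/M M0 eqxx add0r.
case: (boolP [exists i, (map_mx polyC M + 'X%:M) i (s i) == 0]).
  case/existsP=> i /eqP E.
  by rewrite (bigD1 i) //= E mul0r mulr0.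
rewrite negb_exists => /forallP H.
have [i0 hi0] : exists i, s i != i.
  apply/existsP; apply: contraNT s1; rewrite negb_exists => /forallP h.
  apply/eqP/perm.permP => i; rewrite perm1; apply/eqP.
  by have := h i; rewrite negbK.
(* A product without zero factors forces every moved index to advance by [size b] along the cycle
   while reading [b]. *)
have mv i : s i != i -> (s i = (i + size b) %% size a :> nat)%N /\ reads a b i.
  move=> si; apply: Mne; apply: contraNneq (H i) => E.
  by rewrite !mxE -/M E [i == _]eq_sym (negbTE si) addr0.
case: (nread i0) => // k.
(* Iterating [s] from [i0] stays among moved indices, so [b] is read over and over, which [nread]
   excludes. *)
have [i [<- si]] : exists i : 'I_(size a),
    (i = (i0 + k * size b) %% size a :> nat)%N /\ s i != i;
  last exact: (mv _ si).2.
elim: k => [|k [i [E si]]]; first by exists i0; rewrite addn0 modn_small.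
exists (s i); rewrite (inj_eq perm_inj); split=> //.
by rewrite (mv _ si).1 E mulSnr addnA modnDml.
Qed.

(** A direct sum of cycles; an initial zero block pads the size up to [m0], and the factor
    ['X^(size zs)] avoids subtracted exponents. *)
Lemma cycle_sum (s : seq (word d * A)) (m0 : nat) :
  (forall x, x \in s -> is_primitive x.1) ->
  exists m (Y : letter d -> 'M[A]_m), (m0 <= m)%N /\
    forall b, is_primitive b ->
      let zs := [seq x.2 | x <- s & `[< cyc_perm x.1 b >]] in
      charpoly (mxword Y b) * 'X^(size zs) = 'X^m * \prod_(z <- zs) ('X + z%:P).
Proof.
elim: s => [|[a z] s IH] ps.
  exists m0, (fun=> 0); split=> // b [b0 _] /=; rewrite big_nil expr0 !mulr1.
  case: b b0 => // l b _; by rewrite mxword_cons mul0mx charpoly0.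
have [|m [Y [m0m H]]] := IH.
  by move=> x xs; apply: ps; rewrite inE xs orbT.
have pa : is_primitive a by apply: (ps (a, z)); rewrite inE eqxx.
exists _, (fun l => block_mx (cycle_mx a z l) 0 0 (Y l)); split.
  exact: leq_trans m0m (leq_addl _ _).
move=> b pb /=; rewrite mxword_block charpoly_block exprD.
have := charpoly_cycle z pa pb; have := H b pb => /=.
case: (asboolP (cyc_perm a b)) => _ /= E1 E2; last first.
  by rewrite E2 -mulrA E1 mulrA.
by rewrite big_cons exprS mulrACA E1 E2 mulrACA.
Qed.
End WordMatrix.

(** * Passing to the classical groups *)

Definition involletter (A : comNzRingType) (d : nat) (G : classical_group) n
    (X : 'I_d -> 'M[A]_n) (l : letter d) : 'M[A]_n :=
  if l.2 then invol G (X l.1) else X l.1.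

(** [S l] acts as [Y l] on W and as the transpose of [Y (trl l)] on its dual. The symplectic
    involution exchanges [S l] and [S (trl l)] directly; the transpose does so after a conjugation,
    which leaves [msigma] unchanged. *)
Lemma hyperbolic_double (A : comNzRingType) (d : nat) (G : classical_group)
    (iA h : A) m (Y : letter d -> 'M[A]_m) :
  iA * iA = -1 -> h * 2 = 1 ->
  exists X : 'I_d -> 'M[A]_(m + m), forall t b,
    msigma t (mxword (involletter G X) b) =
    (charpoly (mxword Y b) * charpoly (mxword Y (trw b)))`_(m + m - t).
Proof.
move=> ii h2; pose S l : 'M[A]_(m + m) := block_mx (Y l) 0 0 (Y (trl l))^T.
have wordS t b : msigma t (mxword S b) =
    (charpoly (mxword Y b) * charpoly (mxword Y (trw b)))`_(m + m - t).
  rewrite -[msigma t _]/((charpoly (mxword S b))`_(m + m - t)) mxword_block.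
  rewrite charpoly_block (@mxword_rev_tr _ _ _ Y (fun l => (Y (trl l))^T)) //.
  by rewrite charpoly_tr.
case: G; last first.
  exists (fun k : 'I_d => S (k, false)) => t b; rewrite -wordS; congr msigma.
  apply: eq_bigr => -[k []] _ //; rewrite /involletter /= sympJ_block /S.
  rewrite tr_block_mx !trmx0 trmxK !mulmx_block !mul0mx !mulmx0 !mul1mx !mulmx1.
  rewrite !add0r !addr0 !mulNmx !mul1mx !mulmxN !mulmx1 opp_block_mx.
  by rewrite !opprK !oppr0.
(* P P^T = 2 H for H = (0 E; E 0), so conjugation by P turns the transpose into
   M |-> H M^T H, which preserves block diagonal matrices. *)
pose P : 'M[A]_(m + m) := block_mx 1%:M iA%:M 1%:M (- iA)%:M.
pose Q : 'M[A]_(m + m) := h *: block_mx 1%:M 1%:M (- iA)%:M iA%:M.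
have hh (M : 'M[A]_m) : h *: (M + M) = M.
  by rewrite -mulr2n -scaler_nat scalerA h2 scale1r.
have QP : Q *m P = 1%:M.
  rewrite /P /Q -scalemxAl mulmx_block !mul1mx -!scalar_mxM.
  rewrite -!(raddfD (@scalar_mx A m)) /=.
  rewrite !mulrN !mulNr ii !mulr1 !opprK addrC subrr addNr raddf0.
  rewrite scale_block_mx !scaler0 -[1 + 1]/(2%:R) scale_scalar_mx h2.
  by rewrite -scalar_mx_block.
have PQ := mulmx1C QP.
exists (fun k : 'I_d => Q *m S (k, false) *m P) => t b; rewrite -wordS.
have -> : mxword (involletter Orthogonal (fun k => Q *m S (k, false) *m P)) b
    = Q *m mxword S b *m P.
  elim: b => [|l b IH]; first by rewrite !mxword_nil mulmx1 QP.
  rewrite !mxword_cons IH.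
  have -> : involletter Orthogonal (fun k => Q *m S (k, false) *m P) l
      = Q *m S l *m P.
    case: l => k [] //; rewrite /involletter /= !trmx_mul /P /Q /S.
    rewrite [(h *: _)^T]linearZ_LR /= !tr_block_mx !trmx0 !tr_scalar_mx trmxK.
    rewrite -!scalemxAl -!scalemxAr; congr (_ *: _).
    rewrite !mulmx_block !mulmx0 !addr0 !add0r !mul1mx !mulmx1.
    rewrite !mul_scalar_mx !mul_mx_scalar !(scaler0, addr0, add0r).
    rewrite !scalerA !mulrN !mulNr ii !opprK !scale1r /trl /=.
    by congr block_mx; rewrite addrC.
  by rewrite !mulmxA -(mulmxA _ P Q) PQ mulmx1.
by rewrite -mulmxA msigma_mulC -mulmxA PQ mulmx1.
Qed.

(** Passing from [p] to ['X * p + u%:P] shifts the coefficients of the square already prescribed;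
    the new one is [2 * u] plus a known term, so halving determines [u]. *)
Lemma monic_sqrt (A : comNzRingType) (h : A) (c : nat -> A) T :
  h * 2 = 1 -> exists p : {poly A}, [/\ p \is monic, size p = T.+1 &
    forall t, (0 < t <= T)%N -> (p ^+ 2)`_(T + T - t) = c t].
Proof.
move=> h2; elim: T => [|T [p [pm sp cp]]].
  by exists 1; rewrite monic1 size_poly1; split=> // -[].
have lp : p`_T = 1 by move/monicP: pm; rewrite lead_coefE sp.
pose u := h * (c T.+1 - ('X^2 * p ^+ 2)`_T.+1).
have sXp : size ('X * p) = T.+2 by rewrite mulrC size_mulX ?monic_neq0 // sp.
have su : (size (u%:P) < size ('X * p)%R)%N.
  by rewrite sXp ltnS (leq_trans (size_polyC_leq1 _)).
exists ('X * p + u%:P); split.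
- by rewrite monicE lead_coefDl // -monicE monicMl ?monicX.
- by rewrite size_polyDl.
move=> t /andP[t0 tT]; rewrite sqrrD exprMn !coefD -rmorphXn /= coefC.
have -> : (T.+1 + T.+1 - t == 0)%N = false by apply/eqP; lia.
rewrite addr0 -!['X * p * _]mulrA ![('X * (p * _))`_ _]coefXM.
rewrite ifF; last by apply/eqP; lia.
rewrite !coefMC; have [tE|tn] := eqVneq t T.+1.
  rewrite tE addnK /= lp mul1r -mulr2n -mulr_natr /u [h * _ * _]mulrAC h2 mul1r.
  by rewrite addrC subrK.
rewrite (nth_default 0) ?sp; last by lia.
rewrite mul0r !addr0 coefXnM ifF; last by apply/negP; lia.
rewrite -(cp t); last by lia.
by congr (_`_ _); lia.
Qed.

(** * Specializing the generic matrices *)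

Lemma malgU_mul (F : fieldType) (I : choiceType) (m1 m2 : {cmonom I}) :
  << m1 >> * << m2 >> = << mmul m1 m2 >> :> {malg F[{cmonom I}]}.
Proof. by rewrite malgM_def fgmulUU mulr1. Qed.

Lemma cmevalU (F : fieldType) (I : choiceType) (S : comAlgType F)
    (h : I -> S) i : cmeval h (ucm i) = h i.
Proof. by rewrite /cmeval mdomU big_seq_fset1 cmUU. Qed.

Lemma cmeval_ucm (F : fieldType) (I : choiceType) (m : {cmonom I}) :
  cmeval (fun i => << ucm i >> : {malg F[{cmonom I}]}) m = << m >>.
Proof.
have [n] := ubnP (monalg.mdeg m); elim: n m => // n IH m; rewrite ltnS => dm.
have [->|m1] := eqVneq m (mone : {cmonom I}); first exact: mmorph1.
have /fset0Pn [i im] : finsupp m != fset0.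
  apply: contraNneq m1 => m0.
  by rewrite -monalg.mdeg_eq0 monalg.mdegE m0 big_seq_fset0.
have mE : m = mmul (ucm i) (divcm m (ucm i)).
  apply/eqP/cmP => j; rewrite cmM divcmE cmU subnKC //.
  by case: eqP => // <-; rewrite lt0n cmE_neq0.
have IHm : cmeval (fun i => << ucm i >> : {malg F[{cmonom I}]})
    (divcm m (ucm i)) = << divcm m (ucm i) >>.
  apply: IH; apply: leq_trans dm.
  by rewrite [in leqRHS]mE monalg.mdegM monalg.mdegU.
have ev_ucm : cmeval (fun i => << ucm i >> : {malg F[{cmonom I}]}) (ucm i)
    = << ucm i >>.
  exact: cmevalU.
rewrite [in RHS]mE -malgU_mul -IHm -ev_ucm [in LHS]mE.
exact: (cmeval_mmorphism _).1.
Qed.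

Lemma malgU_scale (R : nzRingType) (K : choiceType) (c : R) (k : K) :
  c *: << k >> = << c *g k >> :> {malg R[K]}.
Proof.
apply/malgP => k'; rewrite monalg.mcoeffZ (monalg.mcoeffU k 1).
by rewrite (monalg.mcoeffU k c) mulr_natr.
Qed.

Lemma malg_eval_ucm (F : fieldType) (I : choiceType)
    (f : {malg F[{cmonom I}]}) :
  malg_eval (fun i => << ucm i >>) f = f.
Proof.
rewrite [RHS]monalgE /malg_eval /monalg.mmap; apply: eq_bigr => m _.
rewrite cmeval_ucm /= mulr_algl; exact: malgU_scale.
Qed.

(** Only the variables occurring in [f] have to be matched, so a specialization good for finitely
    many generators suffices. *)
Lemma malg_eval_eq (F : fieldType) (I : choiceType) (S : comAlgType F)
    (B : comNzRingType) (x : I -> S) (e : {rmorphism S -> B})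
    (iota : {rmorphism {malg F[{cmonom I}]} -> B}) (f : {malg F[{cmonom I}]}) :
  (forall c, e c%:A = iota c%:A) ->
  (forall m i, m \in monalg.msupp f -> i \in finsupp m ->
     e (x i) = iota << ucm i >>) ->
  e (malg_eval x f) = iota f.
Proof.
move=> eC ex; rewrite -[in RHS](malg_eval_ucm f) /malg_eval /monalg.mmap.
rewrite !rmorph_sum !big_seq; apply: eq_bigr => m mf.
rewrite !rmorphM /= eC; congr (_ * _).
rewrite /cmeval !rmorph_prod !big_seq; apply: eq_bigr => i im.
by rewrite !rmorphXn /= (ex m).
Qed.

Lemma mpoly_specialize (F : fieldType) (d : nat) (G : classical_group) (n : nat)
    (B : comNzRingType) (phi : {rmorphism F -> B}) (X : 'I_d -> 'M[B]_n) :
  exists e : {rmorphism mpoly (nvars d n) F -> B},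
    (forall c, e c%:A = phi c) /\
    forall a, map_mx e (wordX F G n a) = mxword (involletter G X) a.
Proof.
pose v (m : 'I_(nvars d n)) : B := let: (i, j, k) := enum_val m in X k i j.
exists (mpoly.mmap phi v : {rmorphism _ -> _}); split=> [c|a].
  by rewrite alg_mpolyC /= mpoly.mmapC.
have eX k : map_mx (mpoly.mmap phi v) (genericX F n k) = X k.
  apply/matrixP => i j.
  by rewrite !mxE [LHS]mpoly.mmapX mmap1U /v enum_rankK.
elim: a => [|l a IH]; first by rewrite wordX_nil mxword_nil map_mx1.
rewrite wordX_cons mxword_cons map_mxM IH; congr (_ *m _).
by case: l => k []; rewrite /letterX /involletter /= ?map_invol eX.
Qed.

(** * Prescribing a polynomial for each class of words *)

Definition selfdual d (c : primclass d) : bool :=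
  `[< cyc_perm (repr c) (trw (repr c)) >].

Lemma half_mul2 (F : fieldType) (A : comAlgType F) : 2%N \notin [pchar F] ->
  (2^-1 : F)%:A * 2 = 1 :> A.
Proof.
rewrite inE /= => two0.
by rewrite mulr_natr -scaler_nat scalerA mulfV // scale1r.
Qed.

(* A class with a ~ a^T contributes its roots twice, hence the exponent. *)
Lemma class_poly (A : comNzRingType) (h : A) (T : nat) (dual : bool)
    (x : {t : nat | (0 < t)%N} -> A) : h * 2 = 1 ->
  exists p : {poly A}, [/\ p \is monic, size p = T.+1 &
    forall t, (sval t <= T)%N ->
      (p ^+ dual.+1)`_(dual.+1 * T - sval t) = x t].
Proof.
(* The default 1, taken at [t = 0], supplies the leading coefficient when [dual] is false. *)
move=> h2; pose y t : A := if insub t is Some t' then x t' else 1.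
have yE t : y (sval t) = x t by rewrite /y valK.
case: dual.
  have [p [pm sp cp]] := monic_sqrt y T h2.
  exists p; split=> // t tT; rewrite -yE -cp ?tT ?andbT ?(valP t) //.
  by congr (_`_ (_ - _)%N); rewrite mul2n addnn.
exists (\poly_(i < T.+1) y (T - i)%N).
have y0 : y 0%N = 1 by rewrite /y insubF.
have sp : size (\poly_(i < T.+1) y (T - i)%N) = T.+1.
  by apply: size_poly_eq; rewrite subnn y0 oner_eq0.
split=> // [|t tT].
  by rewrite monicE lead_coefE sp coef_poly ltnSn subnn y0.
by rewrite expr1 mul1n coef_poly ltnS leq_subr subKn.
Qed.

(** Adjoining a square root of -1 and then splitting yields one injective extension for all classes
    in [cs], each with exactly [T] roots. *)
Lemma split_class_poly (A : comNzRingType) (h : A) (K : eqType) (T : nat)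
    (cs : seq K) (dual : K -> bool) (x : {t : nat | (0 < t)%N} -> K -> A) :
  h * 2 = 1 ->
  exists (B : comNzRingType) (iota : {rmorphism A -> B}),
    [/\ injective iota, exists i, i * i = -1 :> B &
    exists z : K -> seq B, forall c, c \in cs ->
      size (z c) = T /\ forall t, (sval t <= T)%N ->
      ((\prod_(r <- z c) ('X + r%:P)) ^+ (dual c).+1)`_
        ((dual c).+1 * T - sval t) = iota (x t c)].
Proof.
move=> h2; have /choice [p pP] c := class_poly T (dual c) (x^~ c) h2.
have pm c : p c \is monic by case: (pP c).
have [C [f [fi [i ii]]]] := adjoin_sqrtN1 A.
have [|B [g [gi [z zP]]]] := @split_polys C _ cs (map_poly f \o p).
  by move=> c; apply: monic_map.
exists B, (g \o f : {rmorphism _ -> _}); split; first exact: inj_comp.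
  by exists (g i); rewrite -rmorphM ii rmorphN1.
exists z => c cs_c; have [_ sp cp] := pP c; split=> [|t tT].
  have := congr1 (size : {poly B} -> nat) (zP _ cs_c).
  rewrite size_map_inj_poly ?rmorph0 // size_map_inj_poly ?rmorph0 // sp.
  have -> : \prod_(r <- z c) ('X + r%:P)
      = \prod_(r <- map -%R (z c)) ('X - r%:P).
    by rewrite big_map; apply: eq_bigr => r _; rewrite polyCN opprK.
  by rewrite size_prod_XsubC size_map => -[].
by rewrite -(zP _ cs_c) /= -map_poly_comp -rmorphXn coef_map cp.
Qed.

Lemma cyc_perm_repr d (c1 c2 : primclass d) :
  word_sim (repr c1) (repr c2) -> c1 = c2.
Proof.
move=> H; rewrite -[c1]reprK -[c2]reprK; apply/eqmodP; exact/asboolP.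
Qed.

(** Among the roots tagged by words, a test met only by the tag of [c] recovers [z c]; the flag [e]
    serves the test against a transpose, met only if [c] is self-dual. *)
Lemma filter_tagged (K : eqType) (W B : Type) (cs : seq K) (w : K -> W)
    (z : K -> seq B) (P : pred W) (c : K) (e : bool) : uniq cs -> c \in cs ->
  (forall c', P (w c') = (c' == c) && e) ->
  [seq x.2 | x <- flatten [seq [seq (w c', y) | y <- z c'] | c' <- cs] & P x.1]
  = if e then z c else [::].
Proof.
move=> ucs ccs Pc.
have block c' : [seq x.2 | x <- [seq (w c', y) | y <- z c'] & P x.1] =
    if (c' == c) && e then z c' else [::].
  rewrite filter_map -map_comp.
  rewrite (eq_filter (a2 := fun=> (c' == c) && e)) => [|y]; last exact: Pc.
  by case: andb; rewrite ?filter_predT ?filter_pred0 ?map_id.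
have notin s : c \notin s ->
    [seq x.2 | x <- flatten [seq [seq (w c', y) | y <- z c'] | c' <- s]
             & P x.1] = [::].
  elim: s => //= k s IH; rewrite inE negb_or eq_sym => /andP[/negbTE ck cs'].
  by rewrite filter_cat map_cat IH // block ck.
elim: cs ucs ccs => //= c' s IH /andP[c's us].
rewrite inE filter_cat map_cat block.
have [cc' _|ne /= cs'] := eqVneq c c'; last by rewrite IH.
by rewrite -cc' in c's *; rewrite notin ?cats0.
Qed.

(** Cycles labelled [repr c], one for each element of [z c], make the product of the polynomials of
    a and a^T equal, up to a power of the variable, to the one prescribed for [c]. *)
Lemma independent_specialization (F : fieldType)
    (char_neq2 : 2%N \notin [pchar F]) (d : nat) (G : classical_group)
    (T : nat) (cs : seq (primclass d)) : uniq cs ->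
  exists n (B : comNzRingType) (iota : {rmorphism Nsigma F d -> B})
      (e : {rmorphism mpoly (nvars d n) F -> B}),
    [/\ admissible G n, injective iota, forall c, e c%:A = iota c%:A &
      forall t c, c \in cs -> (sval t <= T)%N ->
        e (psi_gen F G n (t, c)) = iota << ucm (t, c) >>].
Proof.
move=> ucs; have two := half_mul2 (Nsigma F d) char_neq2.
have [B [iota [iota_inj [i ii] [z zP]]]] :=
  split_class_poly T cs (@selfdual d) (fun t c => << ucm (t, c) >>) two.
pose As := flatten [seq [seq (pword (repr c), y) | y <- z c] | c <- cs].
(* The bound [T.+1] rather than [T] keeps [m] positive, as admissibility requires. *)
have [|m [Y [Tm YP]]] := @cycle_sum d B As T.+1.
  move=> x /flatten_mapP [c _ /mapP [y _ ->]]; exact: primwordP.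
pose h := iota (2^-1 : F)%:A.
have h2 : h * 2 = 1.
  by rewrite /h -(rmorph_nat iota) -rmorphM two rmorph1.
have [X XP] := hyperbolic_double G Y ii h2.
have [e [eC eX]] := mpoly_specialize G
  (iota \o in_alg (Nsigma F d) : {rmorphism F -> B}) X.
exists (m + m)%N, B, iota, e; split=> //.
  case: (G); rewrite /admissible /= ?addnn ?odd_double ?andbT double_gt0.
    exact: leq_trans Tm.
  exact: leq_trans Tm.
move=> t c cs_c tT; rewrite /psi_gen /= ifT; last first.
  exact: leq_trans tT (leq_trans (ltnW Tm) (leq_addr _ _)).
rewrite map_msigma eX XP; have [sz <- //] := zP c cs_c.
have [pr ptr] : is_primitive (repr c) /\ is_primitive (trw (repr c)).
  by split; [|apply: is_primitive_trw]; apply: primwordP.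
have z1 : [seq x.2 | x <- As & `[< cyc_perm x.1 (repr c) >]] = z c.
  apply: (filter_tagged (w := fun c => pword (repr c)) z (e := true)
    (P := fun a => `[< cyc_perm a (repr c) >]) ucs cs_c) => c'.
  rewrite andbT; apply/asboolP/eqP => [H|->]; last exact: cyc_perm_refl.
  by apply: cyc_perm_repr; left.
have z2 : [seq x.2 | x <- As & `[< cyc_perm x.1 (trw (repr c)) >]]
    = if selfdual c then z c else [::].
  apply: (filter_tagged (w := fun c => pword (repr c)) z
    (P := fun a => `[< cyc_perm a (trw (repr c)) >]) ucs cs_c) => c'.
  apply/asboolP/andP => [H|[/eqP -> /asboolP//]].
  have E : c' = c by apply: cyc_perm_repr; right.
  by split; [apply/eqP | rewrite -E; apply/asboolP; rewrite [in trw _]E].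
have := YP _ ptr; have := YP _ pr; rewrite /= z1 z2 sz.
set P := \prod_(x <- z c) _.
set C1 := charpoly _; set C2 := charpoly _ => E1 E2.
(* Both relations are multiplied; a self-dual class contributes [P] twice, any other only through
   [C1]. *)
have E : C1 * C2 * 'X^((selfdual c).+1 * T) = 'X^(m + m) * P ^+ (selfdual c).+1.
  rewrite mulSn !exprD exprS mulrACA E1 [RHS]mulrACA; congr (_ * _).
  move: E2; case: (selfdual c) => /= E2; first by rewrite mul1n -sz E2 expr1.
  by move: E2; rewrite big_nil.
(* This index reads off degree [m + m - sval t] of [C1 * C2] on the left, and on the right degree
   [(selfdual c).+1 * T - sval t] of the power of [P], where the generator was placed. *)
have := congr1
  (fun q : {poly B} => q`_(m + m - sval t + (selfdual c).+1 * T)) E.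
have index s q : (s <= T)%N -> (m + m <= m + m - s + (T + q))%N /\
    (m + m - s + (T + q) - (m + m) = T + q - s)%N by move: Tm; clear; lia.
have [le_mm eq_mm] := index _ (selfdual c * T)%N tT.
by rewrite coefMXn ltnNge leq_addl addnK coefXnM mulSn ltnNge le_mm eq_mm.
Qed.

Local Open Scope classical_set_scope.

Theorem theorem1p1 (F : fieldType) (F_infinite : infinite_set [set: F])
    (char_neq2 : 2%N \notin [pchar F]) (d : nat) (d_ge1 : (1 <= d)%N)
    (G : classical_group) :
  Kinfty F d G = [set 0].
Proof.
apply/seteqP; split=> [f Kf|_ -> n _]; last exact: monalg.mmap0.
pose gens : seq (generator d) :=
  flatten [seq (finsupp m : seq (generator d)) |
             m : {cmonom (generator d)} <- monalg.msupp f].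
have gensP (m : {cmonom (generator d)}) i :
    m \in monalg.msupp f -> i \in finsupp m -> i \in gens.
  move=> mf im; apply/flattenP.
  by exists (finsupp m : seq (generator d)) => //; apply: map_f.
(* Bounds the index t of every generator in [f], so that none of them is truncated to zero in the
   size [n] obtained below. *)
pose T := (\max_(s <- gens) sval s.1)%N.
have [n [B [iota [e [admn iota_inj eC eP]]]]] :=
  independent_specialization char_neq2 G T (undup_uniq [seq s.2 | s <- gens]).
suff E : iota f = 0 by apply: iota_inj; rewrite E rmorph0.
have <- : e (malg_eval (psi_gen F G n) f) = iota f.
  apply: malg_eval_eq => // m [t c] mf im.
  have gens_tc := gensP _ _ mf im; apply: eP.
    by rewrite mem_undup; apply/mapP; exists (t, c).
  exact: (@leq_bigmax_seq _ gens xpredT (fun s => sval s.1) _ gens_tc).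
by rewrite [malg_eval _ _](Kf n admn) rmorph0.
Qed.
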